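(* Let $T=\mathcal{N}\mathcal{C}$ be a model operator (an antilinear normal operator) on $\mathcal{H}=\mathcal{H}_1\oplus\mathcal{H}_2$ as described in the context, with corresponding operators $N_1,N_2,C_1,C_2$. If $N_1$ is $K$-supported, then $T$ is completely non-self-adjoint.
   Context: Hilbert spaces are complex with scalar product linear in the first variable; operators may be unbounded, with products on natural domains and equalities including domains. Antilinear means $A(\alpha x+\beta y)=\overline{\alpha}\,Ax+\overline{\beta}\,Ay$ for $\alpha,\beta\in\mathbb{C}$. A conjugation on a Hilbert space is an everywhere defined antilinear isometric operator $C$ with $C^2=I$. Model operator: $N_1,N_2$ are (possibly unbounded) normal linear operators on Hilbert spaces $\mathcal{H}_1,\mathcal{H}_2$; $\mathcal{N}=\begin{pmatrix}N_1&0\\0&N_2\end{pmatrix}$ on $\mathcal{H}_1\oplus\mathcal{H}_2$; $\mathcal{C}=\begin{pmatrix}0&C_2\\C_1&0\end{pmatrix}$ is a conjugation on $\mathcal{H}_1\oplus\mathcal{H}_2$, with $C_1:\mathcal{H}_1\to\mathcal{H}_2$ and $C_2:\mathcal{H}_2\to\mathcal{H}_1$, such that $\mathcal{N}\mathcal{C}=\mathcal{C}\mathcal{N}$; and $T:=\mathcal{N}\mathcal{C}=\begin{pmatrix}0&N_1C_2\\N_2C_1&0\end{pmatrix}$. $K:=\{z\in\mathbb{C}: z\neq 0,\ 0<\arg z\le\pi/2\}$. A normal linear operator $N$ with spectral measure $E_N$ is $K$-supported if $E_N(\mathbb{C}\setminus K)=0$. For a densely defined antilinear operator $A$ on a Hilbert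 space $\mathcal{G}$, the adjoint $A^\dagger$ is the antilinear operator whose domain consists of all $y\in\mathcal{G}$ for which there is $u\in\mathcal{G}$ with $\langle Ax,y\rangle=\langle u,x\rangle$ for all $x\in\mathcal{D}(A)$; then $A^\dagger y:=u$. $A$ is self-adjoint if $A=A^\dagger$. If $S$ is an antilinear operator on $\mathcal{H}$, a self-adjoint part of $S$ is a self-adjoint antilinear operator $S_0$ acting on a closed subspace $\mathcal{H}_0$ of $\mathcal{H}$ (so $\mathcal{D}(S_0)$ is dense in $\mathcal{H}_0$ and $S_0$ maps $\mathcal{D}(S_0)$ into $\mathcal{H}_0$) with $S_0\subseteq S$. The trivial self-adjoint part is the one with $\mathcal{H}_0=\{0\}$. $S$ is completely non-self-adjoint if its only self-adjoint part is the trivial one. *)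

(* Defs.v *)
From HB Require Import structures.
From mathcomp Require Import all_boot all_order all_algebra.
From mathcomp Require Import complex sesquilinear.
From mathcomp Require Import all_classical all_reals all_analysis.
From mathcomp Require Import ring.

Set Implicit Arguments.
Unset Strict Implicit.
Unset Printing Implicit Defensive.

Import Order.TTheory GRing.Theory Num.Theory.
Import numFieldNormedType.Exports.

Local Open Scope classical_set_scope.
Local Open Scope ring_scope.
Local Open Scope complex_scope.

(* A complex Hilbert space: [inner] is linear in its first variable. *)
HB.mixin Record CompleteNormedModule_isHilbert (R : realType) H
    & CompleteNormedModule R[i] H := {
  inner : {dot H for (@Num.conj R[i])};
  inner_norm : forall x : H, inner x x = `|x| ^+ 2 }.

#[short(type="hilbertType")]
HB.structure Definition Hilbert (R : realType) :=
  {H of CompleteNormedModule R[i] H & CompleteNormedModule_isHilbert R H}.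

Section HilbertSum.
Context {R : realType}.

(* The product type [H1 * H2] carries the max norm of the library, so that the
   orthogonal direct sum has to live on an alias of it. *)
Definition hsum (H1 H2 : hilbertType R) : Type := (H1 * H2)%type.

Context (H1 H2 : hilbertType R).
Local Notation H := (hsum H1 H2).

HB.instance Definition _ := GRing.Lmodule.copy H (H1 * H2)%type.

Definition hsum_inner (x y : H) : R[i] := inner x.1 y.1 + inner x.2 y.2.

Definition hsum_norm (x : H) : R[i] := sqrtC (hsum_inner x x).

Lemma hsum_innerE (x : H) : hsum_inner x x = `|x.1| ^+ 2 + `|x.2| ^+ 2.
Proof. by rewrite /hsum_inner !inner_norm. Qed.

Lemma hsum_inner_ge0 (x : H) : 0 <= hsum_inner x x.
Proof. by rewrite hsum_innerE addr_ge0// exprn_ge0. Qed.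

Lemma hsum_norm_ge0 (x : H) : 0 <= hsum_norm x.
Proof. by rewrite sqrtC_ge0 hsum_inner_ge0. Qed.

Lemma hsum_normD (x y : H) : hsum_norm (x + y) <= hsum_norm x + hsum_norm y.
Proof.
rewrite -(@ler_pXn2r _ 2%N)// ?nnegrE ?addr_ge0 ?hsum_norm_ge0//.
rewrite sqrrD !sqrtCK !hsum_innerE/=.
set a := `|x.1|; set b := `|x.2|; set c := `|y.1|; set d := `|y.2|.
have [a0 b0 c0 d0] : [/\ 0 <= a, 0 <= b, 0 <= c & 0 <= d] by split; exact: normr_ge0.
have key : a * c + b * d <= hsum_norm x * hsum_norm y.
  rewrite -(@ler_pXn2r _ 2%N)// ?nnegrE; last 2 first.
  - by rewrite addr_ge0 ?mulr_ge0.
  - by rewrite mulr_ge0 ?hsum_norm_ge0.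
  rewrite exprMn !sqrtCK !hsum_innerE -/a -/b -/c -/d -subr_ge0.
  have -> : (a ^+ 2 + b ^+ 2) * (c ^+ 2 + d ^+ 2) - (a * c + b * d) ^+ 2
            = (a * d - b * c) ^+ 2 by ring.
  by apply: real_exprn_even_ge0 => //; rewrite rpredB// ?rpredM// ger0_real.
apply: (@le_trans _ _ ((a + c) ^+ 2 + (b + d) ^+ 2)).
  by apply: lerD; rewrite ler_pXn2r// ?nnegrE ?addr_ge0// ler_normD.
have -> : (a + c) ^+ 2 + (b + d) ^+ 2 =
  a ^+ 2 + b ^+ 2 + (a * c + b * d) *+ 2 + (c ^+ 2 + d ^+ 2) by ring.
by rewrite lerD2r lerD2l lerMn2r key orbT.
Qed.

Lemma hsum_normZ (l : R[i]) (x : H) : hsum_norm (l *: x) = `|l| * hsum_norm x.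
Proof.
rewrite /hsum_norm !hsum_innerE/= !normrZ !exprMn -mulrDr.
by rewrite rootCMl ?exprn_ge0// sqrCK.
Qed.

Lemma hsum_norm0_eq0 (x : H) : hsum_norm x = 0 -> x = 0.
Proof.
move/eqP; rewrite sqrtC_eq0 hsum_innerE paddr_eq0 ?exprn_ge0//.
by rewrite !expf_eq0/= !normr_eq0; case: x => a b /= /andP[/eqP-> /eqP->].
Qed.

HB.instance Definition _ :=
  @Lmodule_isNormed.Build R[i] H hsum_norm hsum_normD hsum_normZ hsum_norm0_eq0.

Lemma hsum_normE (x : H) : `|x| = hsum_norm x.
Proof. by []. Qed.

Lemma hsum_norm_fst (x : H) : `|x.1| <= `|x|.
Proof.
rewrite hsum_normE -(@ler_pXn2r _ 2%N)// ?nnegrE ?hsum_norm_ge0//.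
by rewrite sqrtCK hsum_innerE lerDl exprn_ge0.
Qed.

Lemma hsum_norm_snd (x : H) : `|x.2| <= `|x|.
Proof.
rewrite hsum_normE -(@ler_pXn2r _ 2%N)// ?nnegrE ?hsum_norm_ge0//.
by rewrite sqrtCK hsum_innerE lerDr exprn_ge0.
Qed.

Lemma hsum_norm_le (x : H) : `|x| <= `|x.1| + `|x.2|.
Proof.
rewrite hsum_normE -(@ler_pXn2r _ 2%N)// ?nnegrE ?hsum_norm_ge0// ?addr_ge0//.
rewrite sqrtCK hsum_innerE sqrrD -addrA lerD2l lerDr.
by rewrite mulrn_wge0// mulr_ge0.
Qed.

Lemma hsum_complete (F : set_system H) :
  ProperFilter F -> cauchy F -> cvg F.
Proof.
move=> FF /cauchy_ballP Fc.
have [a Fa] : exists a : H1, (fst : H -> H1) @ F --> a.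
  apply/cvg_ex; apply: cauchy_cvg; apply/cauchy_ballP => e e0.
  have [[A B]/= [FA FB] AB] := Fc e e0.
  exists (fst @` A, fst @` B) => /=.
    by split; [apply: filterS FA|apply: filterS FB] => x ?; exists x.
  move=> [_ _] [/= [x Ax <-] [y By <-]].
  have := AB (x, y) (conj Ax By); rewrite -!ball_normE/=.
  by apply: le_lt_trans; exact: (hsum_norm_fst (x - y)).
have [b Fb] : exists b : H2, (snd : H -> H2) @ F --> b.
  apply/cvg_ex; apply: cauchy_cvg; apply/cauchy_ballP => e e0.
  have [[A B]/= [FA FB] AB] := Fc e e0.
  exists (snd @` A, snd @` B) => /=.
    by split; [apply: filterS FA|apply: filterS FB] => x ?; exists x.
  move=> [_ _] [/= [x Ax <-] [y By <-]].
  have := AB (x, y) (conj Ax By); rewrite -!ball_normE/=.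
  by apply: le_lt_trans; exact: (hsum_norm_snd (x - y)).
apply/cvg_ex; exists ((a, b) : H).
apply/cvgrPdist_lt => e e0; near=> x.
apply: (le_lt_trans (hsum_norm_le _)); rewrite [ltRHS]splitr ltrD//=.
- by near: x; move/cvgrPdist_lt : Fa; apply; rewrite divr_gt0.
- by near: x; move/cvgrPdist_lt : Fb; apply; rewrite divr_gt0.
Unshelve. all: by end_near. Qed.

HB.instance Definition _ := Uniform_isComplete.Build H hsum_complete.

Lemma hsum_inner_bilinear :
  bilinear_for ( *%R ) (@Num.conj R[i] \; *%R ) hsum_inner.
Proof.
split=> [y a x z|x a y z]; rewrite /hsum_inner /=.
- by rewrite !linearPl/= mulrDr addrACA.
- by rewrite !linearPr/= mulrDr addrACA.
Qed.

HB.instance Definition _ :=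
  bilinear_isBilinear.Build R[i] H H R[i] _ _ hsum_inner hsum_inner_bilinear.

Lemma hsum_inner_conj (x y : H) :
  hsum_inner x y = (-1) ^+ false * (hsum_inner y x)^*%R.
Proof.
by rewrite /hsum_inner rmorphD/= mulrDr; congr (_ + _); exact: hermitian_subproof.
Qed.

HB.instance Definition _ :=
  isHermitianSesquilinear.Build R[i] H false Num.conj hsum_inner hsum_inner_conj.

Lemma hsum_inner_gt0 (x : H) : x != 0 -> 0 < hsum_inner x x.
Proof.
move=> x0; rewrite lt_def hsum_inner_ge0 andbT; apply: contra_neq x0 => x0.
by apply: hsum_norm0_eq0; rewrite /hsum_norm x0 sqrtC0.
Qed.

HB.instance Definition _ := isDotProduct.Build R[i] H hsum_inner hsum_inner_gt0.

Lemma hsum_inner_norm (x : H) : hsum_inner x x = `|x| ^+ 2.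
Proof. by rewrite hsum_normE sqrtCK. Qed.

HB.instance Definition _ :=
  CompleteNormedModule_isHilbert.Build R H hsum_inner_norm.

End HilbertSum.

Section Operators.
Context {R : realType}.

(* An unbounded operator is identified with its graph, so that inclusion and
   equality of operators (domains included) are those of sets, and products
   have their natural domains. *)
Definition oper (G K : hilbertType R) := set (G * K).

Implicit Types G K L : hilbertType R.

Definition dom G K (A : oper G K) : set G := [set x | exists u, A (x, u)].

Definition functional G K (A : oper G K) :=
  forall x u v, A (x, u) -> A (x, v) -> u = v.

Definition linear_oper G K (A : oper G K) :=
  [/\ functional A, A (0, 0) &
      forall (a : R[i]) x y u v,
        A (x, u) -> A (y, v) -> A (a *: x + y, a *: u + v)].

Definition antilinear_oper G K (A : oper G K) :=
  [/\ functional A, A (0, 0) &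
      forall (a : R[i]) x y u v,
        A (x, u) -> A (y, v) -> A (a *: x + y, a^*%R *: u + v)].

Definition graph G K (f : G -> K) : oper G K := [set p | p.2 = f p.1].

Definition oper_comp G K L (B : oper K L) (A : oper G K) : oper G L :=
  [set p | exists2 y, A (p.1, y) & B (y, p.2)].

Definition densely_defined G K (A : oper G K) := closure (dom A) = setT.

Definition adjoint G K (A : oper G K) : oper K G :=
  [set p | forall x u, A (x, u) -> inner u p.1 = inner x p.2].

Definition normal_oper G (N : oper G G) :=
  [/\ linear_oper N, densely_defined N, closed N &
      oper_comp (adjoint N) N = oper_comp N (adjoint N)].

Definition conjugation G (C : G -> G) :=
  [/\ forall (a b : R[i]) x y, C (a *: x + b *: y) = a^*%R *: C x + b^*%R *: C y,
      forall x, `|C x| = `|x| & forall x, C (C x) = x].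

Definition oper_diag G K (A : oper G G) (B : oper K K) :
    oper (hsum G K) (hsum G K) :=
  [set p | A (p.1.1, p.2.1) /\ B (p.1.2, p.2.2)].

Definition offdiag G K (f : G -> K) (g : K -> G) (x : hsum G K) : hsum G K :=
  (g x.2, f x.1).

Definition closed_subspace G (V : set G) :=
  [/\ closed V, V 0 &
      forall (a : R[i]) x y, V x -> V y -> V (a *: x + y)].

(* The adjoint of an antilinear operator acting on the Hilbert space [V], a
   closed subspace of [G]. *)
Definition antiadjoint G (V : set G) (A : oper G G) : oper G G :=
  [set p | [/\ V p.1, V p.2 &
      forall x u, A (x, u) -> inner u p.1 = inner p.2 x]].

Definition antilinear_selfadjoint G (V : set G) (A : oper G G) :=
  [/\ antilinear_oper A,
      forall x u, A (x, u) -> V x /\ V u,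
      V `<=` closure (dom A) &
      A = antiadjoint V A].

Definition selfadjoint_part G (S : oper G G) (V : set G) (S0 : oper G G) :=
  [/\ closed_subspace V, antilinear_selfadjoint V S0 & S0 `<=` S].

Definition completely_non_selfadjoint G (S : oper G G) :=
  forall V S0, selfadjoint_part S V S0 -> V = [set 0].

End Operators.

(* The Borel sigma-algebra of the complex plane, transported from [R * R]. *)
Section ComplexBorel.
Context {R : realType}.

Definition complex_measurable : set (set R[i]) :=
  [set A | measurable [set p : R * R | A (p.1 +i* p.2)]].

Lemma complex_measurable0 : complex_measurable set0.
Proof. exact: measurable0. Qed.

Lemma complex_measurableC A :
  complex_measurable A -> complex_measurable (~` A).
Proof. exact: measurableC. Qed.

Lemma complex_measurable_bigcup (F : (set R[i])^nat) :
  (forall i, complex_measurable (F i)) -> complex_measurable (\bigcup_i F i).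
Proof. by move=> mF; apply: bigcup_measurable => i _; exact: mF. Qed.

HB.instance Definition _ := isPointed.Build R[i] 0.

HB.instance Definition _ := @isMeasurable.Build default_measure_display R[i]
  complex_measurable complex_measurable0 complex_measurableC
  complex_measurable_bigcup.

End ComplexBorel.

Section SpectralMeasure.
Context {R : realType}.
Context (H : hilbertType R).

Definition orthogonal_projection (P : H -> H) :=
  [/\ forall (a : R[i]) x y, P (a *: x + y) = a *: P x + P y,
      forall x, P (P x) = P x &
      forall x y, inner (P x) y = inner x (P y)].

Record spectral_measure := SpectralMeasure {
  spm :> set R[i] -> H -> H;
  spm_proj : forall A, measurable A -> orthogonal_projection (spm A);
  spmT : forall x, spm setT x = x;
  spm_sigma_additive : forall F : (set R[i])^nat,
    (forall n, measurable (F n)) -> trivIset setT F ->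
    forall x, \sum_(0 <= i < n) spm (F i) x @[n --> \oo]
              --> spm (\bigcup_n F n) x }.

Implicit Types (E : spectral_measure) (f : R[i] -> R[i]) (x y u : H).

(* The measure <E(.)x, x>; its values are real numbers. *)
Definition spm_measure E x (A : set R[i]) : \bar R :=
  (complex.Re (inner (E A x) x))%:E.

Definition spm_int E f x : R[i] :=
  fine (\int[spm_measure E x]_z (complex.Re (f z))%:E) +i*
  fine (\int[spm_measure E x]_z (complex.Im (f z))%:E).

(* The integral of f against the complex measure <E(.)x, y>, which is given by
   polarization of the positive measures <E(.)x, x>. *)
Definition spm_sesqui E f x y : R[i] :=
  let i : R[i] := 0 +i* 1 in
  4^-1 * (spm_int E f (x + y) - spm_int E f (x - y)
          + i * (spm_int E f (x + i *: y) - spm_int E f (x - i *: y))).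

Definition spm_dom E f : set H :=
  [set x | (\int[spm_measure E x]_z (complex.Re (`|f z| ^+ 2))%:E < +oo)%E].

(* The operator int f dE: the vectors y range over its domain, which is dense
   and on which all integrals involved are finite. *)
Definition spectral_integral E f : oper H H :=
  [set p | spm_dom E f p.1 /\
    forall y, spm_dom E f y -> inner p.2 y = spm_sesqui E f p.1 y].

Definition is_spectral_measure_of E (N : oper H H) :=
  N = spectral_integral E id.

(* The spectral measure of a normal operator exists and is unique. *)
Definition supported_in (K : set R[i]) (N : oper H H) :=
  exists2 E, is_spectral_measure_of E N & forall x, E (~` K) x = 0.

End SpectralMeasure.

Section Quadrant.
Context {R : realType}.

Definition is_arg (z : R[i]) (t : R) :=
  - pi < t <= pi /\ z = `|z| * (cos t +i* sin t).

Definition quadrant : set R[i] :=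
  [set z | z != 0 /\ exists2 t : R, is_arg z t & 0 < t <= pi / 2].

End Quadrant.

(* Main.v *)
Require Import Defs.
From HB Require Import structures.
From mathcomp Require Import all_boot all_order all_algebra.
From mathcomp Require Import complex sesquilinear.
From mathcomp Require Import all_classical all_reals all_analysis.
From mathcomp Require Import measurable_realfun ring lra.

(* Writing C = (0, C2; C1, 0), the real-linear map f (x1, x2) = x1 + C2 x2
   satisfies f T = N1 f. Let S be a self-adjoint part of T on V. For the real
   inner product Re <., .> it is a symmetric real-linear operator, and for real
   a, b with b > 0 the operator (S - a)^2 + b^2 maps onto V: this follows from
   projecting (v, 0) onto the closed graph {(b x, S x - a x)}. If D is a small
   square around w = a + b i and Q = E(D) f, then Q S is w Q up to a small
   multiple of Q, so that Q ((S - a)^2 + b^2) is small relative to Q although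
   (S - a)^2 + b^2 >= b^2; hence Q = 0 on V. Countably many such squares cover
   the quadrant, on which b > 0, so f vanishes on V. As V is invariant under
   multiplication by i, where x1 is linear and C2 x2 antilinear, V = 0. *)

Set Implicit Arguments.
Unset Strict Implicit.
Unset Printing Implicit Defensive.

Import Order.TTheory GRing.Theory Num.Theory.
Import numFieldNormedType.Exports.

Local Open Scope classical_set_scope.
Local Open Scope ring_scope.
Local Open Scope complex_scope.

Local Notation J := (0 +i* 1).

(** * The real inner product of a complex Hilbert space *)

Section RealInner.
Context {R : realType} {H : hilbertType R}.
Implicit Types (x y z : H) (a b : R).

Lemma innerC x y : inner x y = (inner y x)^*%R.
Proof. by rewrite [LHS]hermitian_subproof expr0 mul1r. Qed.

(** Antilinear operators are real-linear, and self-adjoint ones are symmetric for this real inner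
    product. [nrm] is the same norm as the ambient one, with values in [R] instead of [R[i]]. *)
Definition rdot x y : R := complex.Re (inner x y).
Definition nrm x : R := complex.Re `|x|.

Lemma normE x : `|x| = (nrm x)%:C.
Proof.
have := normr_ge0 x; rewrite /nrm; case: (`|x|) => p q /=.
by rewrite lecE/= => /andP[/eqP-> _].
Qed.

Lemma nrm_ge0 x : 0 <= nrm x.
Proof. by have := normr_ge0 x; rewrite normE lecR. Qed.

Lemma nrm_sqr x : nrm x ^+ 2 = rdot x x.
Proof. by rewrite /rdot inner_norm normE -rmorphXn. Qed.

Lemma nrmD x y : nrm (x + y) <= nrm x + nrm y.
Proof. by rewrite -lecR rmorphD/= -!normE ler_normD. Qed.

Lemma nrmN x : nrm (- x) = nrm x.
Proof. by rewrite /nrm normrN. Qed.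

Lemma nrm0 : nrm (0 : H) = 0.
Proof. by rewrite /nrm normr0. Qed.

Lemma nrm0_eq0 x : nrm x = 0 -> x = 0.
Proof. by move=> x0; apply/eqP; rewrite -normr_eq0 normE x0. Qed.

Lemma nrmZ (c : R[i]) x : nrm (c *: x) = complex.Re `|c| * nrm x.
Proof.
apply: (@complexI R); rewrite rmorphM/= -!normE normrZ; congr (_ * _).
Qed.

Lemma nrmZr a x : nrm (a%:C *: x) = `|a| * nrm x.
Proof. by rewrite nrmZ normc_def /= expr0n addr0 sqrtr_sqr. Qed.

Lemma nrmZi x : nrm (J *: x) = nrm x.
Proof. by rewrite nrmZ normc_def /= expr0n expr1n add0r sqrtr1 mul1r. Qed.

Lemma rdotC x y : rdot x y = rdot y x.
Proof. by rewrite /rdot innerC; case: (inner y x). Qed.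

Lemma rdotDl x y z : rdot (x + y) z = rdot x z + rdot y z.
Proof. by rewrite /rdot linearDl raddfD. Qed.

Lemma rdotDr x y z : rdot x (y + z) = rdot x y + rdot x z.
Proof. by rewrite rdotC rdotDl -!(rdotC x). Qed.

Lemma rdotNl x y : rdot (- x) y = - rdot x y.
Proof. by rewrite /rdot linearNl raddfN. Qed.

Lemma rdotNr x y : rdot x (- y) = - rdot x y.
Proof. by rewrite rdotC rdotNl rdotC. Qed.

Lemma rdotZl a x y : rdot (a%:C *: x) y = a * rdot x y.
Proof. by rewrite /rdot linearZl_LR /=; case: (inner x y) => p q /=; ring. Qed.

Lemma rdotZr a x y : rdot x (a%:C *: y) = a * rdot x y.
Proof. by rewrite rdotC rdotZl rdotC. Qed.

Lemma rdotZi x y : rdot (J *: x) y = - complex.Im (inner x y).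
Proof. by rewrite /rdot linearZl_LR /=; case: (inner x y) => p q /=; ring. Qed.

Definition rdotE := (rdotDl, rdotDr, rdotNl, rdotNr, rdotZl, rdotZr).

Lemma rdot0l x : rdot 0 x = 0.
Proof. by rewrite -(scale0r x) -(rmorph0 (real_complex R)) rdotZl mul0r. Qed.

Lemma nrm_parallelogram x y :
  nrm (x + y) ^+ 2 + nrm (x - y) ^+ 2 = 2 * (nrm x ^+ 2 + nrm y ^+ 2).
Proof. by rewrite !nrm_sqr !rdotE (rdotC y x); ring. Qed.

Lemma rdot_cauchy x y : `|rdot x y| <= nrm x * nrm y.
Proof.
have [y0|y0] := eqVneq (nrm y) 0.
  by rewrite (nrm0_eq0 y0) rdotC rdot0l normr0 nrm0 mulr0.
have yp : 0 < nrm y by rewrite lt_def y0 nrm_ge0.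
rewrite -(@ler_pXn2r _ 2%N)// ?nnegrE ?mulr_ge0 ?nrm_ge0// real_normK ?num_real//.
(* This square expands to [nrm y ^+ 2] times the defect in the Cauchy-Schwarz inequality. *)
have := sqr_ge0 (nrm ((nrm y ^+ 2)%:C *: x - (rdot x y)%:C *: y)).
rewrite [X in 0 <= X]nrm_sqr !rdotE (rdotC y x) -!nrm_sqr => h.
have : 0 <= nrm y ^+ 2 * (nrm x ^+ 2 * nrm y ^+ 2 - rdot x y ^+ 2) by nra.
by rewrite pmulr_rge0 ?exprn_gt0// subr_ge0 exprMn.
Qed.

Lemma nrm_sqrBZ a x y :
  nrm (x - a%:C *: y) ^+ 2 = nrm x ^+ 2 - 2 * a * rdot x y + a ^+ 2 * nrm y ^+ 2.
Proof. by rewrite !nrm_sqr !rdotE (rdotC y x); ring. Qed.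

Lemma inner_Re_Im x y : inner x y = rdot x y +i* rdot x (J *: y).
Proof.
rewrite (rdotC x (J *: y)) rdotZi (innerC y x) /rdot.
by case: (inner x y) => p q /=; rewrite opprK.
Qed.

Lemma rdotZc (c : R[i]) x y :
  rdot (c *: x) y = complex.Re c * rdot x y - complex.Im c * rdot x (J *: y).
Proof.
by rewrite {1}/rdot linearZl_LR /= inner_Re_Im; case: c => p q.
Qed.

End RealInner.

(** * Orthogonal projection onto closed real subspaces *)

Section Projection.
Context {R : realType} {H : hilbertType R}.
Implicit Types (x y z : H) (a b : R).

(** Only real scalars occur, since the graph of an antilinear operator is not a complex subspace. *)
Definition real_subspace (G : set H) :=
  G 0 /\ forall a x y, G x -> G y -> G (a%:C *: x + y).

Lemma complex_gt0P (e : R[i]) : 0 < e -> exists2 r : R, 0 < r & e = r%:C.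
Proof.
case: e => p q; rewrite ltcE/= => /andP[/eqP q0 p0]; exists p => //.
by rewrite q0.
Qed.

Lemma cauchy_seq_cvg (u : H^nat) :
  (forall e : R, 0 < e ->
    exists N, forall n m, (N <= n)%N -> (N <= m)%N -> nrm (u n - u m) < e) ->
  exists l : H, u @ \oo --> l.
Proof.
move=> cu; apply/cvg_ex; apply: cauchy_cvg; apply/cauchy_ballP => e.
move=> /complex_gt0P[r r0 ->]; have [N uN] := cu r r0.
exists (u @` [set n | (N <= n)%N], u @` [set n | (N <= n)%N]) => /=.
  by split; exists N => // n /= Nn; exists n.
move=> [_ _] [/= [n Nn <-] [m Nm <-]].
by rewrite -ball_normE/= normE ltcR; exact: uN.
Qed.

Lemma cvg_nrm_lt {T : Type} {F : set_system T} {FF : Filter F} (u : T -> H)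
  (l : H) : u @ F --> l ->
  forall e : R, 0 < e -> \forall t \near F, nrm (l - u t) < e.
Proof.
move=> /cvgrPdist_lt ul e e0.
have := ul e%:C; rewrite ltcR => /(_ e0); apply: filterS => t.
by rewrite normE ltcR.
Qed.

Lemma rdot_cvg {T : Type} {F : set_system T} {FF : Filter F} (u : T -> H)
  (l x : H) : u @ F --> l -> rdot (u t) x @[t --> F] --> rdot l x.
Proof.
move=> ul; apply/cvgrPdist_lt => e e0.
have K0 : 0 < nrm x + 1 by rewrite ltr_wpDl// nrm_ge0.
have d0 : 0 < e / (nrm x + 1) by rewrite divr_gt0.
apply: filterS (cvg_nrm_lt ul d0) => t.
rewrite ltr_pdivlMr// => h; rewrite -rdotNl -rdotDl.
apply: le_lt_trans (rdot_cauchy _ _) _; apply: le_lt_trans h.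
by rewrite ler_wpM2l ?nrm_ge0// lerDl.
Qed.

(** A sequence minimizing the distance to [v] is Cauchy by the parallelogram law; orthogonality is
    the first variation at its limit. *)
Lemma projection_exists (G : set H) : closed G -> real_subspace G ->
  forall v, exists2 p, G p & forall g, G g -> rdot (v - p) g = 0.
Proof.
move=> cG [G0 GD] v.
have GDr x y : G x -> G y -> G (x + y) by move=> /(GD 1) h /h; rewrite scale1r.
pose S := [set nrm (v - g) ^+ 2 | g in G].
pose D := inf S.
have S0 : S !=set0 by exists (nrm (v - 0) ^+ 2); exists 0.
have lS : has_lbound S by exists 0 => _ [g _ <-]; rewrite sqr_ge0.
have DS g : G g -> D <= nrm (v - g) ^+ 2 by move=> Gg; apply: ge_inf => //; exists g.
have /choice[u uP] (n : nat) : exists g, G g /\ nrm (v - g) ^+ 2 < D + n.+1%:R^-1.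
  have [|_ [g Gg <-] gD] := @inf_adherent _ S n.+1%:R^-1 _ (conj S0 lS).
    by rewrite invr_gt0.
  by exists g.
have small e : 0 < e -> exists N, forall n, (N <= n)%N -> n.+1%:R^-1 < e :> R.
  move=> e0; have := near_infty_natSinv_lt (PosNum e0); case=> N _ h.
  by exists N => n /h.
(* The midpoint of [u n] and [u m] lies in [G], so its squared distance to [v] is at least [D]. *)
have cauchy_u n m : nrm (u n - u m) ^+ 2 <= 2 * (n.+1%:R^-1 + m.+1%:R^-1).
  have [Gn un] := uP n; have [Gm um] := uP m.
  have := nrm_parallelogram (v - u m) (v - u n).
  have := DS (2^-1%:C *: (u n + u m)).
  have -> : v - u m - (v - u n) = u n - u m.
    by rewrite opprB addrC addrA subrK.
  have -> : v - u m + (v - u n) = 2%:C *: (v - 2^-1%:C *: (u n + u m)).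
    rewrite scalerBr scalerA -rmorphM/= divff// scale1r rmorph_nat scaler_nat.
    by rewrite mulr2n opprD addrACA [- _ - _]addrC.
  rewrite nrmZr exprMn real_normK ?num_real// => h1.
  have : D <= nrm (v - 2^-1%:C *: (u n + u m)) ^+ 2.
    by apply: h1; rewrite -[_ *: _]addr0; apply: GD => //; exact: GDr.
  move: un um; move: (n.+1%:R^-1) (m.+1%:R^-1) => en em.
  by move=> *; lra.
have [p up] : exists p : H, u @ \oo --> p.
  apply: cauchy_seq_cvg => e e0.
  have [|N hN] := small (e ^+ 2 / 4); first by rewrite divr_gt0// exprn_gt0.
  exists N => n m /hN hn /hN hm.
  rewrite -(@ltr_pXn2r _ 2%N)// ?nnegrE ?nrm_ge0 ?ltW//.
  apply: (le_lt_trans (cauchy_u n m)); move: hn hm.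
  by move: (n.+1%:R^-1) (m.+1%:R^-1) => *; lra.
have Gp : G p.
  by apply: (closed_cvg _ cG _ _ up); apply: nearW => n; have [] := uP n.
exists p => // g Gg.
have key t : 2 * t * rdot (v - p) g <= t ^+ 2 * nrm g ^+ 2.
  apply/ler_addgt0Pr => e e0.
  (* With [K] the two errors add up to [e]: the defect of [u n] in the infimum, and the cost
     [2 * |t| * nrm (p - u n) * nrm g] of replacing [u n] by [p]. *)
  pose K := 1 + 2 * `|t| * nrm g.
  have K0 : 0 < K by rewrite ltr_wpDr// !mulr_ge0// nrm_ge0.
  have d0 : 0 < e / K by rewrite divr_gt0.
  have [N hN] := small _ d0.
  have [n [pn Nn]] : exists n, nrm (p - u n) < e / K /\ (N <= n)%N.
    have [n0 _ h0] := cvg_nrm_lt up d0.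
    exists (maxn n0 N); rewrite leq_maxr; split => //.
    by apply: h0 => /=; rewrite leq_maxl.
  have [Gn un] := uP n.
  have := DS (t%:C *: g + u n) (GD _ _ _ Gg Gn).
  have -> : v - (t%:C *: g + u n) = (v - u n) - t%:C *: g.
    by rewrite opprD addrCA addrC.
  rewrite nrm_sqrBZ => Dt.
  have -> : v - p = (v - u n) - (p - u n) by rewrite opprB addrA subrK.
  rewrite rdotDl rdotNl.
  have : `|t * rdot (p - u n) g| <= `|t| * (e / K * nrm g).
    rewrite normrM ler_wpM2l//; apply: (le_trans (rdot_cauchy _ _)).
    by rewrite ler_wpM2r ?nrm_ge0// ltW.
  rewrite ler_norml => /andP[h1 h2].
  have h3 : n.+1%:R^-1 < e / K by exact: hN.
  have h4 : e / K + 2 * (`|t| * (e / K * nrm g)) = e.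
    by rewrite -[RHS](divfK (lt0r_neq0 K0)) {4}/K; ring.
  move: un Dt h1 h2 h3 h4; move: (e / K) => eK.
  by move: (rdot _ _) (rdot _ _) => c1 c2; move: (_.+1%:R^-1) => ? *; lra.
set c := rdot (v - p) g in key *.
(* For this [t] the inequality [key] becomes [c ^+ 2 * (nrm g ^+ 2 + 2) <= 0]; the [+ 1] in the
   denominator covers [g = 0]. *)
have := key (c / (nrm g ^+ 2 + 1)).
set G2 := nrm g ^+ 2; have G20 : 0 <= G2 by exact: sqr_ge0.
have G21 : 0 < G2 + 1 by lra.
rewrite -(@ler_pM2r _ ((G2 + 1) ^+ 2)) ?exprn_gt0//.
have -> : 2 * (c / (G2 + 1)) * c * (G2 + 1) ^+ 2 = 2 * c ^+ 2 * (G2 + 1).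
  by field; rewrite lt0r_neq0.
have -> : (c / (G2 + 1)) ^+ 2 * G2 * (G2 + 1) ^+ 2 = c ^+ 2 * G2.
  by field; rewrite lt0r_neq0.
move=> h; apply/eqP; rewrite -sqrf_eq0 eq_le sqr_ge0 andbT.
have := mulr_ge0 (sqr_ge0 c) G20; have := sqr_ge0 c.
by move: h; rewrite mulrDr mulr1 -mulrA; move: (c ^+ 2 * G2) => ? *; lra.
Qed.

End Projection.

(** * Spectral measures *)

Section SpectralMeasure.
Context {R : realType} {H : hilbertType R}.
Variable E : spectral_measure H.
Implicit Types (x y z : H) (A B : set R[i]).

Lemma spmP A : measurable A ->
  forall c x y, E A (c *: x + y) = c *: E A x + E A y.
Proof. by move=> /(spm_proj E)[]. Qed.

Lemma spm_idem A x : measurable A -> E A (E A x) = E A x.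
Proof. by move=> /(spm_proj E)[]. Qed.

Lemma spm_sym A x y : measurable A -> rdot (E A x) y = rdot x (E A y).
Proof. by move=> /(spm_proj E)[_ _]; rewrite /rdot => ->. Qed.

Lemma spmD A x y : measurable A -> E A (x + y) = E A x + E A y.
Proof. by move=> mA; rewrite -[x in LHS]scale1r spmP// scale1r. Qed.

Lemma spm_0r A : measurable A -> E A 0 = 0.
Proof.
by move=> mA; apply: (@addrI _ (E A 0)); rewrite -spmD// !addr0.
Qed.

Lemma spmZ A c x : measurable A -> E A (c *: x) = c *: E A x.
Proof. by move=> mA; rewrite -[_ *: _ in LHS]addr0 spmP// spm_0r// addr0. Qed.

Lemma spmB A x y : measurable A -> E A (x - y) = E A x - E A y.
Proof. by move=> mA; rewrite addrC -scaleN1r spmP// scaleN1r addrC. Qed.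

Lemma spm_nrm A x : measurable A -> nrm (E A x) ^+ 2 = rdot (E A x) x.
Proof. by move=> mA; rewrite nrm_sqr -spm_sym// spm_idem. Qed.

Lemma spm_contract A x : measurable A -> nrm (E A x) <= nrm x.
Proof.
move=> mA; have [->|x0] := eqVneq (nrm (E A x)) 0; first exact: nrm_ge0.
have xp : 0 < nrm (E A x) by rewrite lt_def x0 nrm_ge0.
rewrite -(ler_pM2l xp) -expr2 spm_nrm//.
exact: (le_trans (ler_norm _) (rdot_cauchy _ _)).
Qed.

(** Countable additivity for the constantly empty sequence makes the multiples of [E set0 x]
    converge, while consecutive ones differ by [E set0 x]. *)
Lemma spm_set0 x : E set0 x = 0.
Proof.
have tF : trivIset setT (fun _ : nat => set0 : set R[i]).
  by apply/trivIsetP => *; rewrite setI0.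
have := @spm_sigma_additive R H E _ (fun=> measurable0) tF x.
move=> /cvg_nrm_lt h; apply: nrm0_eq0; apply/eqP; rewrite eq_le nrm_ge0 andbT.
apply/ler_addgt0Pr => e e0; rewrite add0r.
have e20 : 0 < e / 2 by rewrite divr_gt0.
have [N _ hN] := h _ e20.
have := hN N (leqnn N); have := hN N.+1 (leqnSn N).
rewrite /= big_nat_recr//= bigcup0//.
set l := E _ x; set s := \sum_(_ <= _ < _) _ => h1 h2.
have -> : l = (l - s) - (l - (s + l)) by rewrite opprB addrC addrA addrNK addrC addKr.
by apply: (le_trans (nrmD _ _)); rewrite nrmN; lra.
Qed.

Lemma spmU A B x : measurable A -> measurable B -> [disjoint A & B] ->
  E (A `|` B) x = E A x + E B x.
Proof.
move=> mA mB AB.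
have mF n : measurable (bigcup2 A B n) by case: n => [|[|n]] /=.
have tF : trivIset setT (bigcup2 A B).
  by rewrite -trivIset_bigcup2; apply/disj_set2P.
have := @spm_sigma_additive R H E _ mF tF x.
rewrite bigcup2E => h; apply: cvg_unique h _ => //.
apply: cvg_near_cst; exists 2 => // -[|[|n]]//= _.
rewrite big_nat_recl// big_nat_recl//= big1 ?addr0// => i _.
exact: spm_set0.
Qed.

(** Put [a = E A (E B x)]. Idempotence of [E (A]|[B) = E A + E B] at [E B x] yields [E B a = - a],
    and [E B] is positive, so [a = 0]. *)
Lemma spm_disj A B x : measurable A -> measurable B -> [disjoint A & B] ->
  E A (E B x) = 0.
Proof.
move=> mA mB AB.
have mAB : measurable (A `|` B) by exact: measurableU.
have := spm_idem (E B x) mAB; rewrite !spmU// !spm_idem// !spmD// !spm_idem//.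
set a := E A (E B x); rewrite addrA => /addIr; rewrite -addrA -[RHS]addr0 => /addrI h.
have Ba : E B a = - a by apply/eqP; rewrite -addr_eq0 addrC h.
have := spm_nrm a mB; rewrite Ba nrmN rdotNl -nrm_sqr => h2.
by apply: nrm0_eq0; apply/eqP; rewrite -sqrf_eq0; apply/eqP; lra.
Qed.

(* [spm_measure] takes arbitrary values, possibly negative ones, on
   non-measurable sets, hence this variant. *)
Definition pmeas x A : \bar R := (nrm (E A x) ^+ 2)%:E.

Lemma pmeas0 x : pmeas x set0 = 0%E.
Proof. by rewrite /pmeas spm_set0 nrm0 expr0n. Qed.

Lemma pmeas_ge0 x A : (0 <= pmeas x A)%E.
Proof. by rewrite lee_fin sqr_ge0. Qed.

Lemma pmeas_sigma x : semi_sigma_additive (pmeas x).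
Proof.
move=> F mF tF mUF; rewrite /pmeas.
have := @rdot_cvg R H nat \oo eventually_filter _ _ x
  (@spm_sigma_additive R H E F mF tF x).
move=> h; under eq_fun do rewrite sumEFin.
apply/cvg_EFin; first exact: nearW.
rewrite /comp/= spm_nrm//; apply: cvg_trans h; apply: near_eq_cvg.
apply: nearW => n /=.
rewrite /rdot; rewrite linear_sumlz raddf_sum; apply: eq_bigr => i _.
by rewrite spm_nrm.
Qed.

HB.instance Definition _ x := isMeasure.Build _ _ _ (pmeas x)
  (pmeas0 x) (pmeas_ge0 x) (@pmeas_sigma x).

Lemma pmeas_fin x : fin_num_fun (pmeas x). Proof. by []. Qed.

HB.instance Definition _ x := Measure_isFinite.Build _ _ _ (pmeas x) (@pmeas_fin x).

Import HBNNSimple.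

(** The integral sees a set function only through simple functions, whose level sets are measurable,
    and there the two set functions agree. *)
Lemma integral_spm x (f : R[i] -> \bar R) :
  (\int[spm_measure E x]_z f z = \int[pmeas x]_z f z)%E.
Proof.
rewrite /integral.
have eqs (g : {nnsfun R[i] >-> R}) :
    sintegral (spm_measure E x) g = sintegral (pmeas x) g.
  apply: eq_fsbigr => r _; congr (_ * _)%E.
  by rewrite /spm_measure /pmeas spm_nrm.
by congr (ereal_sup _ - ereal_sup _)%E; apply: eq_imagel => g _; exact: eqs.
Qed.

End SpectralMeasure.

(** * Local estimate for a spectral integral *)

Section Square.
Context {R : realType}.
Implicit Types (z w : R[i]) (e : R).

Lemma measurable_Re : measurable_fun setT (fun z : R[i] => complex.Re z).
Proof.
move=> _ B mB; rewrite setTI /measurable/= /complex_measurable/=.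
by rewrite -[X in measurable X]setTI; exact: measurable_fst.
Qed.

Lemma measurable_Im : measurable_fun setT (fun z : R[i] => complex.Im z).
Proof.
move=> _ B mB; rewrite setTI /measurable/= /complex_measurable/=.
by rewrite -[X in measurable X]setTI; exact: measurable_snd.
Qed.

Definition square w e : set R[i] :=
  [set z | `|complex.Re z - complex.Re w| <= e /\
           `|complex.Im z - complex.Im w| <= e].

Lemma measurable_square w e : measurable (square w e).
Proof.
have mh (h : R[i] -> R) c : measurable_fun setT h ->
    measurable [set z | `|h z - c| <= e].
  move=> mh; rewrite -[X in measurable X]setTI.
  apply: (@measurable_fun_le _ _ _ setT (fun z => `|h z - c|) (cst e)) => //.
  by apply: measurableT_comp => //; exact: measurable_funB.
by apply: measurableI; apply: mh; [exact: measurable_Re|exact: measurable_Im].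
Qed.

Lemma normc_sqr z : complex.Re (`|z| ^+ 2) = complex.Re z ^+ 2 + complex.Im z ^+ 2.
Proof.
by case: z => a b; rewrite normc_def -rmorphXn/= sqr_sqrtr// addr_ge0// sqr_ge0.
Qed.

Lemma measurable_normc_sqr :
  measurable_fun setT (fun z : R[i] => complex.Re (`|z| ^+ 2)).
Proof.
apply: (eq_measurable_fun (fun z => complex.Re z ^+ 2 + complex.Im z ^+ 2)).
  by move=> z _; rewrite normc_sqr.
apply: measurable_funD; apply: measurable_funX.
  exact: measurable_Re.
exact: measurable_Im.
Qed.

End Square.

Section LocalEstimate.
Context {R : realType} {H : hilbertType R}.
Variables (E : spectral_measure H) (w : R[i]) (e : R).
Hypothesis e0 : 0 < e.
Local Notation D := (square w e).
Local Notation mD := (measurable_square w e).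
Implicit Types (x y t : H).

Lemma pmeas_out y t A : E D t = t -> measurable A -> A `<=` ~` D ->
  pmeas E (y + t) A = pmeas E y A.
Proof.
move=> Dt mA AD; rewrite /pmeas spmD// -[in E A t]Dt spm_disj ?addr0//.
  exact: mD.
by apply/disj_set2P; rewrite disjoints_subset.
Qed.

Lemma fine_pmeas_in y t : E D t = t -> fine (pmeas E (y + t) D) = nrm (E D y + t) ^+ 2.
Proof. by move=> Dt; rewrite /= spmD ?Dt//; exact: mD. Qed.

Lemma spm_domE x : spm_dom E id x <->
  (\int[pmeas E x]_z (complex.Re (`|z| ^+ 2))%:E < +oo)%E.
Proof. by rewrite /spm_dom /= integral_spm. Qed.

Lemma normc_sqr_square z : D z ->
  complex.Re (`|z| ^+ 2) <= (`|complex.Re w| + e) ^+ 2 + (`|complex.Im w| + e) ^+ 2.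
Proof.
rewrite normc_sqr => -[h1 h2].
have le2 (a b : R) : `|a - b| <= e -> a ^+ 2 <= (`|b| + e) ^+ 2.
  move=> h; rewrite -real_normK ?num_real// ler_pXn2r ?nnegrE ?addr_ge0 ?(ltW e0)//.
  by have := ler_normD (a - b) b; rewrite subrK => h3; lra.
by rewrite lerD// le2.
Qed.

(** On [D] the integrand is bounded and the measure finite; off [D] the vector [t] does not change
    the measure. *)
Lemma spm_domD y t : spm_dom E id y -> E D t = t -> spm_dom E id (y + t).
Proof.
move=> /spm_domE yd Dt; apply/spm_domE.
have msq : measurable_fun setT (fun z : R[i] => (complex.Re (`|z| ^+ 2))%:E).
  by apply/measurable_EFinP; exact: measurable_normc_sqr.
have sq0 (z : R[i]) : (0 <= (complex.Re (`|z| ^+ 2))%:E :> \bar R)%E.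
  by rewrite normc_sqr lee_fin addr_ge0// sqr_ge0.
have mDc : measurable (~` D) by apply: measurableC; exact: mD.
rewrite -(setUv D) ge0_integral_setU//; [|exact: mD|by rewrite setUv|]; last first.
  by apply/disj_set2P; rewrite setICr.
apply: lte_add_pinfty.
  pose M : R := (`|complex.Re w| + e) ^+ 2 + (`|complex.Im w| + e) ^+ 2.
  have M0 : (0 <= M%:E)%E by rewrite lee_fin addr_ge0// sqr_ge0.
  have h : (\int[pmeas E (y + t)%R]_(z in D) (complex.Re (`|z| ^+ 2))%:E <=
     \int[pmeas E (y + t)%R]_(z in D) (cst M%:E z))%E.
    apply: ge0_le_integral => //; first exact: mD.
    - exact: measurable_funS msq.
    - by move=> z Dz; rewrite lee_fin; exact: normc_sqr_square.
  apply: (le_lt_trans h).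
  by rewrite integral_cst; [rewrite lte_mul_pinfty// ltry|exact: mD].
rewrite (eq_measure_integral (pmeas E y)); last first.
  by move=> A mA AD; exact: pmeas_out.
by apply: le_lt_trans yd; exact: ge0_subset_integral.
Qed.

Lemma spm_dom_range t : E D t = t -> spm_dom E id t.
Proof.
move=> Dt; rewrite -[t]add0r; apply: spm_domD => //; apply/spm_domE.
rewrite (eq_measure_integral mzero) ?integral_measure_zero//.
by move=> A mA _; rewrite /= /pmeas spm_0r// nrm0 expr0n.
Qed.

(** * Integrals of a real coordinate [h] of [z], with [c] its value at [w] *)

Section Coordinate.
Variables (h : R[i] -> R) (c : R).
Hypothesis mh : measurable_fun setT h.
Hypothesis h_le : forall z, `|h z| <= 1 + complex.Re (`|z| ^+ 2).
Hypothesis h_near : forall z, D z -> `|h z - c| <= e.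

Lemma coordinate_integrable x : spm_dom E id x ->
  (pmeas E x).-integrable setT (EFin \o h).
Proof.
move=> /spm_domE xd.
apply: (@le_integrable _ _ _ (pmeas E x) setT measurableT (EFin \o h)
  (fun z => (EFin \o cst 1%R) z + (complex.Re (`|z| ^+ 2))%:E)%E) => //.
- exact/measurable_EFinP.
- by move=> z _ /=; rewrite lee_fin (le_trans (h_le z))// ler_norm.
apply: (@integrableD _ _ _ (pmeas E x) setT measurableT (EFin \o cst 1%R)
  (fun z => (complex.Re (`|z| ^+ 2))%:E)); first exact: finite_measure_integrable_cst.
apply/integrableP; split.
  by apply/measurable_EFinP; exact: measurable_normc_sqr.
under eq_integral.
  move=> z _; rewrite gee0_abs; last by rewrite normc_sqr lee_fin addr_ge0// sqr_ge0.
  over.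
exact: xd.
Qed.

(** The part off [D] does not depend on [t], so it will cancel in the polarization formula. On [D]
    the function [h] is within [e] of [c], and [D] has mass [nrm (E D y + t) ^+ 2]. *)
Lemma coordinate_integral y t : spm_dom E id y -> E D t = t ->
  `|fine (\int[spm_measure E (y + t)%R]_z (h z)%:E)
    - (Rintegral (pmeas E y) (~` D) h + c * nrm (E D y + t) ^+ 2)|
  <= e * nrm (E D y + t) ^+ 2.
Proof.
move=> yd Dt; rewrite integral_spm.
have ih := coordinate_integrable (spm_domD yd Dt).
have mDc : measurable (~` D) by apply: measurableC; exact: mD.
have iD : (pmeas E (y + t)).-integrable D (EFin \o h).
  by apply: integrableS ih => //; exact: mD.
have ic a : (pmeas E (y + t)).-integrable D (EFin \o cst a).
  by apply: finite_measure_integrable_cst; exact: mD.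
rewrite -/(Rintegral _ _ h) -[X in Rintegral _ X]/(setT) -(setUv D) Rintegral_setU//.
- have -> : Rintegral (pmeas E (y + t)) (~` D) h = Rintegral (pmeas E y) (~` D) h.
    by congr fine; apply: eq_measure_integral => A mA AD; exact: pmeas_out.
  have := Rintegral_cst (pmeas E (y + t)) mD; rewrite fine_pmeas_in// => Ic.
  have lo : (c - e) * nrm (E D y + t) ^+ 2 <= \int[pmeas E (y + t)]_(z in D) h z.
    rewrite -Ic; apply: le_Rintegral => //; [exact: mD|exact: ic|].
    by move=> z /h_near; rewrite ler_norml => /andP[? ?]; lra.
  have hi : \int[pmeas E (y + t)]_(z in D) h z <= (c + e) * nrm (E D y + t) ^+ 2.
    rewrite -Ic; apply: le_Rintegral => //; [exact: mD|exact: ic|].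
    by move=> z /h_near; rewrite ler_norml => /andP[? ?]; lra.
  move: lo hi; rewrite ler_norml mulrBl mulrDl.
  by move: (Rintegral _ _ _) (Rintegral _ _ _) => ? ? *; apply/andP; split; lra.
- exact: mD.
- by rewrite setUv.
- by apply/disj_set2P; rewrite setICr.
Qed.

End Coordinate.
Lemma Re_polarization (p q r s : R[i]) :
  complex.Re (4^-1 * (p - q + J * (r - s))) =
  4^-1 * (complex.Re p - complex.Re q - (complex.Im r - complex.Im s)).
Proof.
have -> : 4^-1 = (4^-1)%:C :> R[i] by rewrite fmorphV rmorph_nat.
by case: p q r s => [p1 p2] [q1 q2] [r1 r2] [s1 s2] /=; ring.
Qed.

(** Polarization combines the vectors [y + t], [y - t], [y + J *: t], [y - J *: t]: the parts off
    [D] cancel, the values at [w] assemble to [w *: E D y], and by the parallelogram law the four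
    errors average to the bound. *)
Lemma spectral_integral_near y t u : spectral_integral E id (y, u) -> E D t = t ->
  `|rdot (u - w *: y) t| <= e * (nrm (E D y) ^+ 2 + nrm t ^+ 2).
Proof.
move=> [/= yd hu] Dt.
have DZ a : E D (a *: t) = a *: t by rewrite spmZ ?Dt//; exact: mD.
have DN : E D (- t) = - t by rewrite -scaleN1r DZ.
have DNJ : E D (- (J *: t)) = - (J *: t) by rewrite -scaleNr DZ.
have hRe := @coordinate_integral (fun z => complex.Re z) (complex.Re w)
  measurable_Re _ (fun z Dz => proj1 Dz) y _ yd.
have hIm := @coordinate_integral (fun z => complex.Im z) (complex.Im w)
  measurable_Im _ (fun z Dz => proj2 Dz) y _ yd.
have leRe (z : R[i]) : `|complex.Re z| <= 1 + complex.Re (`|z| ^+ 2).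
  rewrite normc_sqr -[complex.Re z ^+ 2]real_normK ?num_real//.
  have := sqr_ge0 (complex.Im z); have := sqr_ge0 (`|complex.Re z| - 1).
  by nra.
have leIm (z : R[i]) : `|complex.Im z| <= 1 + complex.Re (`|z| ^+ 2).
  rewrite normc_sqr -[complex.Im z ^+ 2]real_normK ?num_real//.
  have := sqr_ge0 (complex.Re z); have := sqr_ge0 (`|complex.Im z| - 1).
  by nra.
have h1 := hRe leRe _ Dt.
have h2 := hRe leRe _ DN.
have h3 := hIm leIm _ (DZ J).
have h4 := hIm leIm _ DNJ.
have -> : rdot (u - w *: y) t = complex.Re (spm_sesqui E id y t) -
   (complex.Re w * rdot (E D y) t - complex.Im w * rdot (E D y) (J *: t)).
  rewrite -hu; last exact: spm_dom_range Dt.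
  rewrite rdotDl rdotNl -/(rdot u t); congr (_ - _).
  by rewrite rdotZc !spm_sym ?Dt ?DZ//; exact: mD.
rewrite Re_polarization /=.
move: h1 h2 h3 h4; move: (fine _) (fine _) (fine _) (fine _) => i1 i2 i3 i4.
move: (Rintegral _ _ _) (Rintegral _ _ _) => k1 k2.
have JJ : rdot (J *: t) (J *: t) = rdot t t by rewrite -!nrm_sqr nrmZi.
rewrite !nrm_sqr !rdotE !(rdotC _ (E D y)) JJ.
move: (rdot (E D y) (E D y)) (rdot (E D y) t) (rdot (E D y) (J *: t)) (rdot t t).
move=> a b c d.
rewrite !ler_norml => /andP[? ?] /andP[? ?] /andP[? ?] /andP[? ?].
by apply/andP; split; lra.
Qed.

Lemma spectral_integral_local y u : spectral_integral E id (y, u) ->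
  nrm (E D u - w *: E D y) <= 2 * e * nrm (E D y).
Proof.
move=> yu; have mD' := measurable_square w e.
rewrite -spmZ// -spmB//; set g := E D (u - w *: y).
have Dg : E D g = g by rewrite /g spm_idem.
(* Testing with [t = s%:C *: g] bounds [s * nrm g ^+ 2] by [e * nrm (E D y) ^+ 2 + e * s ^+ 2 * nrm
   g ^+ 2]; for [s = (2 * e)^-1] the last term is half of the left side and can be absorbed. *)
have [s s0 es] : exists2 s, 0 < s & 2 * e * s = 1.
  by exists (2 * e)^-1; rewrite ?invr_gt0 ?mulr_gt0// mulfV// mulf_neq0// lt0r_neq0.
have Dt : E D (s%:C *: g) = s%:C *: g by rewrite spmZ// Dg.
have := spectral_integral_near yu Dt.
rewrite nrmZr exprMn real_normK ?num_real// rdotZr -{1}Dg -spm_sym// -/g -nrm_sqr.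
move=> /(le_trans (ler_norm _)).
move=> h.
rewrite -(@ler_pXn2r _ 2%N)// ?nnegrE ?nrm_ge0 ?mulr_ge0 ?nrm_ge0 ?(ltW e0)// exprMn.
rewrite -(ler_pM2l s0).
have -> : s * ((2 * e) ^+ 2 * nrm (E D y) ^+ 2) = 2 * e * nrm (E D y) ^+ 2.
  by rewrite -[RHS]mul1r -[X in _ = X * _]es; ring.
have : e * (s ^+ 2 * nrm g ^+ 2) = s * nrm g ^+ 2 / 2.
  by rewrite -[RHS]mul1r -[X in _ = X * _]es; field.
by move: h; rewrite mulrDr => ? ?; lra.
Qed.

End LocalEstimate.

(** * The quadrant *)

Section Support.
Context {R : realType} {H : hilbertType R}.

Lemma quadrantE : quadrant = [set z : R[i] | 0 <= complex.Re z /\ 0 < complex.Im z].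
Proof.
have pi0 := pi_gt0 R.
apply/seteqP; split => [z [z0 [t [_ zt] /andP[t0 tpi]]]|[a b] /= [a0 b0]].
  have r0 : 0 < complex.Re `|z|.
    by have := z0; rewrite -normr_gt0 ltcE => /andP[].
  have zr : `|z| = (complex.Re `|z|)%:C.
    by have := normr_ge0 z; rewrite lecE; case: (`|z|) => p q /= /andP[/eqP->].
  move: zt; rewrite zr; move: (complex.Re _) r0 => r r0.
  case: z z0 {zr} => a b _ /eqP.
  rewrite eq_complex/= !mul0r subr0 addr0 => /andP[/eqP -> /eqP ->]; split.
    apply: mulr_ge0; first exact: ltW.
    by apply: cos_ge0_pihalf; apply/andP; split; lra.
  by apply: mulr_gt0 => //; apply: sin_gt0_pi; apply/andP; split; lra.
pose r := Num.sqrt (a ^+ 2 + b ^+ 2).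
have r20 : 0 < a ^+ 2 + b ^+ 2 by rewrite ltr_wpDl ?sqr_ge0// exprn_gt0.
have r0 : 0 < r by rewrite sqrtr_gt0.
have rr : r ^+ 2 = a ^+ 2 + b ^+ 2 by rewrite sqr_sqrtr// ltW.
have ar : a < r by rewrite -(@ltr_pXn2r _ 2%N)// ?nnegrE ?(ltW r0)// rr ltrDl exprn_gt0.
have x0 : 0 <= a / r by rewrite divr_ge0// ltW.
have x1 : a / r < 1 by rewrite ltr_pdivrMr// mul1r.
have xI : -1 <= a / r <= 1 by apply/andP; split; lra.
split; first by rewrite eq_complex/= negb_and (lt0r_neq0 b0) orbT.
(* The arccosine is the argument because the imaginary part is positive. *)
exists (acos (a / r)).
  split; first by have ? := acos_ge0 xI; rewrite acos_lepi// andbT; lra.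
  rewrite normc_def/= -/r acosK// sin_acos//.
  have -> : Num.sqrt (1 - (a / r) ^+ 2) = b / r.
    have -> : 1 - (a / r) ^+ 2 = (b / r) ^+ 2.
      apply: (mulIf (lt0r_neq0 (exprn_gt0 2 r0))).
      by rewrite mulrBl mul1r -!exprMn !divfK ?lt0r_neq0// rr; ring.
    by rewrite sqrtr_sqr ger0_norm// divr_ge0// ltW.
  apply/eqP; rewrite eq_complex/= !mul0r subr0 addr0.
  by rewrite ![r * _]mulrC !divfK ?lt0r_neq0// !eqxx.
rewrite acos_gt0 ?x1 ?andbT; last by lra.
rewrite leNgt -ltr_cos ?in_itv/= ?acos_ge0 ?acos_lepi//; last first.
  by apply/andP; split; lra.
by rewrite cos_pihalf acosK ?in_itv// -leNgt.
Qed.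

Lemma measurable_quadrant : measurable (quadrant : set R[i]).
Proof.
have -> : quadrant = (fun z : R[i] => complex.Re z) @^-1` `[0, +oo[
                     `&` (fun z : R[i] => complex.Im z) @^-1` `]0, +oo[.
  by rewrite quadrantE; apply/seteqP; split => z /=; rewrite !in_itv/= !andbT.
apply: measurableI; rewrite -[X in measurable X]setTI.
  by apply: measurable_Re => //; exact: measurable_itv.
by apply: measurable_Im => //; exact: measurable_itv.
Qed.

(** Countably many of the squares cover the quadrant, so the whole plane is null for [pmeas E x],
    whose total mass is [nrm x ^+ 2]. *)
Lemma spm_supported_eq0 (E : spectral_measure H) x :
  (forall y, E (~` quadrant) y = 0) ->
  (forall w, 0 < complex.Im w -> E (square w (complex.Im w / 16)) x = 0) -> x = 0.
Proof.
(* The squares have rational centres in the upper half-plane; indices that encode no such centre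
   give the empty set. *)
move=> Eq Es; pose F k := if @unpickle (rat * rat)%type k is Some (p, q) then
    (if 0 < q then square (ratr p +i* ratr q) (ratr q / 16) else set0)
  else set0 : set R[i].
have negl A : measurable A -> E A x = 0 -> (pmeas E x).-negligible A.
  by move=> mA EA; exists A; split => //; rewrite /= /pmeas EA nrm0 expr0n.
have : (pmeas E x).-negligible setT.
  apply: (@negligibleS _ _ _ _ (\bigcup_k F k `|` ~` quadrant)); last first.
    apply: negligibleU.
      apply: negligible_bigcup => k; rewrite /F.
      case: unpickle => [[p q]|]; last exact: negligible_set0.
      case: ltP => q0; last exact: negligible_set0.
      apply: negl; first exact: measurable_square.
      by apply: (Es (ratr p +i* ratr q)); rewrite /= ltr0q.
    by apply: negl => //; apply: measurableC; exact: measurable_quadrant.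
  move=> z _; have [zq|zq] := pselect (quadrant z); last by right.
  left; move: zq; rewrite quadrantE => -[_ /=].
  set y := complex.Im z => y0.
  (* The lower end [y * 16 / 17] ensures [y < q + q / 16], so that [y] is within the half-side
     [q / 16] of [q]. *)
  have [q] := @rat_in_itvoo R (y * 16 / 17) y ltac:(lra).
  rewrite in_itv/= => /andP[q1 q2].
  have q0 : 0 < ratr q :> R by lra.
  have [p] := @rat_in_itvoo R (complex.Re z) (complex.Re z + ratr q / 16) ltac:(lra).
  rewrite in_itv/= => /andP[p1 p2].
  exists (pickle (p, q)); first exact: I.
  rewrite /F pickleK -(ltr0q R) q0.
  by split; rewrite /= ler_norml; apply/andP; split; rewrite -/y; lra.
move=> /negligibleP => /(_ measurableT) [].
by rewrite /= /pmeas spmT => /eqP; rewrite sqrf_eq0 => /eqP /nrm0_eq0.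
Qed.

End Support.

(** * Self-adjoint antilinear operators *)

Lemma conj_real_complex (R : realType) (a : R) : (a%:C)^*%R = a%:C :> R[i].
Proof. exact: conjc_real. Qed.

Section HilbertSumReal.
Context {R : realType} {G K : hilbertType R}.
Implicit Types p q : hsum G K.

Lemma rdot_hsum p q : rdot p q = rdot p.1 q.1 + rdot p.2 q.2.
Proof. exact: raddfD. Qed.

Lemma nrm_hsum_sqr p : nrm p ^+ 2 = nrm p.1 ^+ 2 + nrm p.2 ^+ 2.
Proof. by rewrite !nrm_sqr rdot_hsum. Qed.

Lemma hsum_fst_continuous : continuous (fst : hsum G K -> G).
Proof.
move=> p; apply/(@cvgrPdist_lt _ _ _ _ (@nbhs_filter (hsum G K) p)) => e e0.
have : nbhs p (ball p e) by exact: nbhsx_ballx.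
apply: filterS => q; rewrite -ball_normE /=; exact: le_lt_trans (hsum_norm_fst (p - q)).
Qed.

Lemma hsum_snd_continuous : continuous (snd : hsum G K -> K).
Proof.
move=> p; apply/(@cvgrPdist_lt _ _ _ _ (@nbhs_filter (hsum G K) p)) => e e0.
have : nbhs p (ball p e) by exact: nbhsx_ballx.
apply: filterS => q; rewrite -ball_normE /=; exact: le_lt_trans (hsum_norm_snd (p - q)).
Qed.

End HilbertSumReal.

Section AntilinearSelfadjoint.
Context {R : realType} {G : hilbertType R}.
Variables (V : set G) (S : oper G G).
Hypothesis V_closed : closed_subspace V.
Hypothesis S_sa : antilinear_selfadjoint V S.
Implicit Types (x y u v : G) (a b : R).

Lemma subspaceD x y : V x -> V y -> V (x + y).
Proof. by case: V_closed => _ _ VD /(VD 1) h /h; rewrite scale1r. Qed.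

Lemma subspaceZ (c : R[i]) x : V x -> V (c *: x).
Proof. by case: V_closed => _ V0 VD /(VD c) /(_ V0); rewrite addr0. Qed.

(** The real part of the adjoint identity suffices: at [J *: x], with image [J^* *: u] by
    antilinearity, it gives the imaginary part at [x]. *)
Lemma antilinear_selfadjointP p q : S (p, q) <->
  [/\ V p, V q & forall x u, S (x, u) -> rdot u p = rdot q x].
Proof.
have [[_ S0 SD] SV _ SE] := S_sa; split=> [Spq|[Vp Vq h]].
  have [Vp Vq] := SV _ _ Spq; split => // x u Sxu.
  by move: Spq; rewrite {1}SE => -[_ _ /(_ _ _ Sxu)]; rewrite /rdot => /= ->.
rewrite SE; split => //= x u Sxu.
have := SD J x 0 u 0 Sxu S0; rewrite !addr0 => /h hJ.
rewrite (inner_Re_Im u p) (inner_Re_Im q x) -(h _ _ Sxu) -hJ rdotZc /=.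
by rewrite mul0r sub0r mulN1r opprK.
Qed.

(** As [S] is its own adjoint, membership in its graph is a family of closed conditions. The
    parameters allow for the shifted and rescaled graph projected onto below. *)
Lemma antilinear_selfadjoint_closed {H : hilbertType R} (f g : H -> G)
  (c d : R[i]) : continuous f -> continuous g ->
  closed [set p | S (c *: f p, g p + d *: f p)].
Proof.
move=> cf cg; have [Vc _ _] := V_closed.
pose X p : G := c *: f p.
pose U p : G := g p + d *: f p.
have cX : continuous X by move=> p; apply: cvgZr; exact: cf.
have cU : continuous U.
  by move=> p; apply: cvgD; [exact: cg|apply: cvgZr; exact: cf].
have -> : [set p | S (X p, U p)] = X @^-1` V `&` U @^-1` V `&`
    \bigcap_(xu in S) (fun p => rdot (X p) xu.2 - rdot (U p) xu.1) @^-1` [set 0].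
  apply/seteqP; split=> p /=.
    move=> /antilinear_selfadjointP [? ? h]; split => // -[x u] /= /h.
    by rewrite rdotC => ->; rewrite subrr.
  move=> [[? ?] h]; apply/antilinear_selfadjointP; split => // x u /h /=.
  by rewrite rdotC => /eqP; rewrite subr_eq0 => /eqP.
apply: closedI; first by apply: closedI; apply: preimage_closed.
apply: closed_bigI => -[x u] _; apply: preimage_closed => //.
move=> p _; apply: (@cvgB R R); apply: rdot_cvg; [exact: cX|exact: cU].
Qed.

(** The last conclusion encodes [(S - a)^2 x + b^2 x = b v]. Projecting [(v, 0)] onto the graph
    gives [x] with [<v - b x, b x'> = <(S - a) x, (S - a) x'>] for all [x'] in the domain; hence
    [(S - a) x] is in the domain of the adjoint, which is [S]. *)
Lemma antilinear_selfadjoint_resolvent a b v : 0 < b -> V v ->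
  exists x u, [/\ V x, S (x, u), nrm (b%:C *: x) <= nrm v &
    S (u - a%:C *: x,
       a%:C *: (u - a%:C *: x) + b%:C *: v - (b ^+ 2)%:C *: x)].
Proof.
move=> b0 Vv; have [[_ S00 SD] SV _ _] := S_sa; have [Vc V0 VD] := V_closed.
have bn0 := lt0r_neq0 b0.
(* [X] and [U] invert the map sending [(x, u)] to [(b x, u - a x)]. *)
pose X (p : hsum G G) : G := b^-1%:C *: p.1.
pose U (p : hsum G G) : G := p.2 + (a / b)%:C *: p.1.
pose Gr : set (hsum G G) := [set p | S (X p, U p)].
have GrS x u : S (x, u) -> Gr (b%:C *: x, u - a%:C *: x).
  move=> Sxu; rewrite /Gr /X /U /= !scalerA -!rmorphM/= mulVf// scale1r.
  by rewrite divfK// subrK.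
have cGr : closed Gr.
  by apply: antilinear_selfadjoint_closed;
    [exact: hsum_fst_continuous|exact: hsum_snd_continuous].
have GrR : real_subspace Gr.
  split; first by rewrite /Gr /X /U /= !scaler0 addr0.
  move=> c p q Gp Gq; have := SD c%:C _ _ _ _ Gp Gq; rewrite conj_real_complex.
  rewrite /Gr /X /U /=; congr (S (_, _)).
    by rewrite scalerDr !scalerA mulrC.
  by rewrite !scalerDr !scalerA addrACA [c%:C * _]mulrC.
have [p Gp pP] := projection_exists cGr GrR (v, 0).
exists (X p), (U p).
have [Vx Vu] := SV _ _ Gp.
have pX : b%:C *: X p = p.1 by rewrite /X scalerA -rmorphM/= divff// scale1r.
have pU : U p - a%:C *: X p = p.2 by rewrite /U /X scalerA -rmorphM/= addrK.
split => //.
  (* The residual is orthogonal to [p] itself, whence [nrm p.1 ^+ 2 <= rdot v p.1]. *)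
  rewrite pX; have := pP p Gp; rewrite rdot_hsum /= !rdotDl !rdotNl -!nrm_sqr rdot0l.
  have := sqr_ge0 (nrm p.2); have := ler_norm (rdot v p.1).
  have := rdot_cauchy v p.1; have := nrm_ge0 p.1; rewrite le_eqVlt => /predU1P[<-|p0].
    by rewrite nrm_ge0.
  move=> h1 h2 h3 h4; rewrite -(ler_pM2r p0) -expr2; lra.
apply/antilinear_selfadjointP; rewrite pU.
have Vy : V p.2 by rewrite -pU -scaleNr; apply: subspaceD => //; exact: subspaceZ.
split => //.
  apply: subspaceD; first by apply: subspaceD; exact: subspaceZ.
  by rewrite -scaleNr; exact: subspaceZ.
move=> x u /GrS/pP; rewrite rdot_hsum /= -pX !rdotE rdot0l.
rewrite (rdotC u).
by rewrite rdot0l -[b ^+ 2]/(b * b) -[b * b * _]mulrA mulKf// mulVKf// => ?; lra.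
Qed.

End AntilinearSelfadjoint.

(** * Vanishing of approximate intertwiners *)

Section Vanishing.
Context {R : realType} {G K : hilbertType R}.
Variables (V : set G) (S : oper G G).
Hypothesis V_closed : closed_subspace V.
Hypothesis S_sa : antilinear_selfadjoint V S.

(* Off the real axis [w] is at distance [Im w] from the spectrum of the
   real-symmetric operator [S], hence no nonzero bounded [Q] can intertwine [S]
   with an operator that is close to [w]. *)
Lemma almost_intertwiner_eq0 (Q : G -> K) (M : R) (w : R[i]) :
  (forall x y, Q (x + y) = Q x + Q y) ->
  (forall (a : R) x, Q (a%:C *: x) = a%:C *: Q x) ->
  0 <= M -> (forall x, nrm (Q x) <= M * nrm x) ->
  0 < complex.Im w ->
  (forall x u, S (x, u) ->
    nrm (Q u - w *: Q x) <= complex.Im w / 8 * nrm (Q x)) ->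
  forall v, V v -> Q v = 0.
Proof.
move=> QD QZ M0 QM b0 QS.
set a := complex.Re w; set b := complex.Im w in b0 QS *.
have QN x : Q (- x) = - Q x.
  by rewrite -scaleN1r -(rmorphN1 (real_complex R)) QZ rmorphN1 scaleN1r.
have wE : w = a%:C + b%:C * J.
  apply/eqP; rewrite eq_complex /=.
  by apply/andP; split; apply/eqP; rewrite /a /b; ring.
(* The witness is [b x] with [x] from the resolvent lemma. The errors sum to
   [(9/64 + 8/64) * b ^+ 2 * q], below the required [b ^+ 2 * q / 2]. *)
have half v : V v -> exists2 x, V x & nrm x <= nrm v /\ nrm (Q v) <= 2^-1 * nrm (Q x).
  move=> Vv.
  have [x [u [Vx Sxu xv]]] := antilinear_selfadjoint_resolvent V_closed S_sa a b0 Vv.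
  set y := u - a%:C *: x; set c := _ - _ => Syc.
  exists (b%:C *: x); first exact: subspaceZ.
  split => //; rewrite QZ nrmZr gtr0_norm//.
  set q := nrm (Q x).
  have q0 : 0 <= q by exact: nrm_ge0.
  pose e1 := Q u - w *: Q x; pose e2 := Q c - w *: Q y.
  have he1 : nrm e1 <= b / 8 * q by exact: QS.
  have he2 : nrm e2 <= b / 8 * nrm (Q y) by exact: QS.
  have Qy : Q y = (b%:C * J) *: Q x + e1.
    rewrite /y QD QN QZ /e1 addrCA -scalerBl wE opprD addrCA subrr addr0.
    by rewrite scaleNr.
  have hJ z : nrm ((b%:C * J) *: z) = b * nrm z.
    by rewrite -scalerA nrmZr nrmZi gtr0_norm.
  have hy : nrm (Q y) <= b * q + b / 8 * q.
    by rewrite Qy (le_trans (nrmD _ _))// hJ lerD.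
  (* Applying [Q] to [(S - a)^2 x + b^2 x = b v], the main terms [(b J)^2] and [b^2] cancel and only
     the errors remain. *)
  have Qv : b%:C *: Q v = e2 + (b%:C * J) *: e1.
    have -> : e1 = Q y - (b%:C * J) *: Q x by rewrite Qy addrC addKr.
    rewrite /e2 /c QD QN (QD (a%:C *: y)) !QZ wE scalerDl scalerBr scalerA.
    have -> : b%:C * J * (b%:C * J) = - (b ^+ 2)%:C.
      by apply/eqP; rewrite eq_complex /=; apply/andP; split; apply/eqP; ring.
    rewrite scaleNr opprK opprD !addrA addrNK.
    by rewrite addrAC subrK addrAC subrr add0r.
  have : nrm (b%:C *: Q v) <= b / 8 * nrm (Q y) + b * (b / 8 * q).
    rewrite Qv (le_trans (nrmD _ _))// lerD// hJ ler_wpM2l//; exact: ltW.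
  rewrite nrmZr gtr0_norm// => h; rewrite -(ler_pM2l b0) (le_trans h)//.
  have : b / 8 * nrm (Q y) <= b / 8 * (b * q + b / 8 * q).
    by rewrite ler_wpM2l// divr_ge0// ltW.
  have := mulr_ge0 (sqr_ge0 b) q0.
  by rewrite expr2 => ? ?; nra.
(* Iterating [half] doubles [nrm (Q v)] at each step without increasing the norm of the vector,
   against the bound [M]. *)
have decay n v : V v -> nrm (Q v) * (2 ^ n)%:R <= M * nrm v.
  elim: n v => [|n IH] v Vv; first by rewrite expn0 mulr1.
  have [x Vx [xv Qx]] := half v Vv.
  rewrite expnS natrM mulrA; apply: (@le_trans _ _ (nrm (Q x) * (2 ^ n)%:R)).
    by rewrite ler_wpM2r//; lra.
  by apply: (le_trans (IH x Vx)); rewrite ler_wpM2l.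
move=> v Vv; apply: nrm0_eq0; apply/eqP; rewrite eq_le nrm_ge0 andbT leNgt.
apply/negP => Qv0.
have := archi_boundP (divr_ge0 (mulr_ge0 M0 (nrm_ge0 v)) (ltW Qv0)).
set n := Num.bound _; rewrite ltr_pdivrMr// => h.
have := decay n v Vv; apply/negP; rewrite -ltNge (lt_le_trans h)// mulrC.
by rewrite ler_pM2l// ler_nat ltnW// ltn_expl.
Qed.

End Vanishing.

(** * Application to the model operator *)

Theorem proposition21 (R : realType) (H1 H2 : hilbertType R)
    (N1 : oper H1 H1) (N2 : oper H2 H2) (C1 : H1 -> H2) (C2 : H2 -> H1)
    (N1_normal : normal_oper N1) (N2_normal : normal_oper N2)
    (C_conj : conjugation (offdiag C1 C2))
    (NC_comm : oper_comp (oper_diag N1 N2) (graph (offdiag C1 C2)) =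
               oper_comp (graph (offdiag C1 C2)) (oper_diag N1 N2))
    (N1_supp : supported_in quadrant N1) :
  completely_non_selfadjoint
    (oper_comp (oper_diag N1 N2) (graph (offdiag C1 C2))).
Proof.
move=> V S0 [Vc Ssa ST].
have [Clin Cnorm Cinv] := C_conj.
have [E N1E Esupp] := N1_supp.
have [[_ _ N1lin] _ _ _] := N1_normal.
have C2P (a b : R[i]) y y' :
    C2 (a *: y + b *: y') = a^*%R *: C2 y + b^*%R *: C2 y'.
  by have := Clin a b ((0, y) : hsum H1 H2) ((0, y') : hsum H1 H2); case.
have C1P (a b : R[i]) y y' :
    C1 (a *: y + b *: y') = a^*%R *: C1 y + b^*%R *: C1 y'.
  by have := Clin a b ((y, 0) : hsum H1 H2) ((y', 0) : hsum H1 H2); case.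
have C1_0 : C1 0 = 0.
  by have := C1P 0 0 0 0; rewrite !scale0r addr0 rmorph0 !scale0r addr0.
have C2Z (c : R[i]) y : C2 (c *: y) = c^*%R *: C2 y.
  by have := C2P c 0 y 0; rewrite !scale0r addr0 rmorph0 scale0r addr0.
have C2D y y' : C2 (y + y') = C2 y + C2 y'.
  by have := C2P 1 1 y y'; rewrite rmorph1 !scale1r.
have C2K x : C2 (C1 x) = x by have := Cinv ((x, 0) : hsum H1 H2); case.
have C2n y : nrm (C2 y) = nrm y.
  apply/eqP; rewrite -(@eqrXn2 _ 2%N) ?nrm_ge0//; apply/eqP.
  have /(congr1 (fun z => complex.Re z ^+ 2)) := Cnorm ((0, y) : hsum H1 H2).
  by rewrite -!/(nrm _) !nrm_hsum_sqr /= C1_0 !nrm0 expr0n addr0 add0r.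
pose f (x : hsum H1 H2) : H1 := x.1 + C2 x.2.
have fD x y : f (x + y) = f x + f y by rewrite /f C2D addrACA.
have fZ (a : R) x : f (a%:C *: x) = a%:C *: f x.
  by rewrite /f C2Z conj_real_complex scalerDr.
have fn x : nrm (f x) <= 2 * nrm x.
  have h1 : nrm x.1 <= nrm x by rewrite -lecR -!normE hsum_norm_fst.
  have h2 : nrm x.2 <= nrm x by rewrite -lecR -!normE hsum_norm_snd.
  by have := nrmD x.1 (C2 x.2); rewrite C2n /f => ?; lra.
(* The first component of [T x] is [N1 (C2 x.2)]. Writing [T x] as the conjugate of
   [z = (N1 x.1, N2 x.2)] by commutation puts [x.1] in the domain of [N1] and gives
   [C2 u.2 = C2 (C1 z.1) = N1 x.1]. *)
have fS x u : S0 (x, u) -> N1 (f x, f u).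
  move=> /ST Txu.
  have [y yx [/= h1 _]] := Txu.
  have {}yx : y = offdiag C1 C2 x := yx.
  move: Txu; rewrite NC_comm => -[z /= [/= h2 _] uz].
  have {}uz : u = offdiag C1 C2 z := uz.
  rewrite yx /= in h1.
  have -> : f u = z.1 + u.1 by rewrite /f {2}uz /= C2K addrC.
  by have := N1lin 1 _ _ _ _ h2 h1; rewrite !scale1r.
have fV v : V v -> f v = 0.
  move=> Vv; apply: (spm_supported_eq0 Esupp) => w w0.
  (* Half-side [Im w / 16] produces the relative error [2 * e = Im w / 8] that the vanishing lemma
     tolerates. *)
  have e0 : 0 < complex.Im w / 16 by rewrite divr_gt0.
  have mD := measurable_square w (complex.Im w / 16).
  apply: (almost_intertwiner_eq0 (M := 2) Vc Ssa
    (Q := fun x => E (square w (complex.Im w / 16)) (f x)) _ _ _ _ w0) => //.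
  - by move=> x y; rewrite fD spmD.
  - by move=> a x; rewrite fZ spmZ.
  - by move=> x; apply: (le_trans (spm_contract _ _ _)).
  - move=> x u /fS; rewrite N1E => /(spectral_integral_local w e0).
    by have -> : 2 * (complex.Im w / 16) = complex.Im w / 8 by field.
apply/seteqP; split => [v Vv|_ ->]; last by have [_ V0 _] := Vc.
have v12 : v.1 = - C2 v.2 by apply/eqP; rewrite -addr_eq0; exact/eqP/(fV v Vv).
(* At [J *: v] the antilinear summand changes sign relative to the linear one:
   [J *: v.1 - J *: C2 v.2 = 0]. With [v.1 = - C2 v.2] this forces [C2 v.2 = 0]. *)
have := fV _ (subspaceZ Vc J Vv); rewrite /f /= C2Z v12.
have -> : J^*%R = - J :> R[i] by apply/eqP; rewrite eq_complex /= oppr0 !eqxx.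
rewrite scaleNr scalerN -opprD -scalerDr => /eqP; rewrite oppr_eq0 scaler_eq0.
rewrite eq_complex /= oner_eq0 andbF /= -mulr2n -scaler_nat scaler_eq0 pnatr_eq0.
move=> /= /eqP C20.
have v20 : v.2 = 0 by apply: nrm0_eq0; rewrite -C2n C20 nrm0.
by rewrite /= [v]surjective_pairing v12 C20 v20 oppr0.
Qed.
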